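(* Let $r$ be a nonnegative integer. For every integer $n\geq 0$, we have the polynomial identity in $x$ $$(x+r)^n=\sum_{k=0}^n T_r(n+r,k+r)\,x^{[k]}.$$
   Context: Central factorials: $x^{[0]}=1$ and, for $n\ge 1$, $x^{[n]}=x\prod_{j=1}^{n-1}\left(x+\frac n2-j\right)=x\left(x+\frac n2-1\right)\left(x+\frac n2-2\right)\cdots\left(x-\frac n2+1\right)$. For a nonnegative integer $r$, the extended $r$-central factorial numbers of the second kind $T_r(n+r,k+r)$ ($n\ge k\ge 0$) are defined by the formal power series identity $$\frac{1}{k!}e^{rt}\left(e^{t/2}-e^{-t/2}\right)^k=\sum_{n=k}^\infty T_r(n+r,k+r)\frac{t^n}{n!},\qquad k\ge 0.$$ *)

(* Defs.v *)
From HB Require Import structures.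
From mathcomp Require Import all_boot all_order all_algebra.
Set Implicit Arguments.
Unset Strict Implicit.
Unset Printing Implicit Defensive.
Import Order.TTheory GRing.Theory Num.Theory.
Local Open Scope ring_scope.

(* A formal power series is its sequence of coefficients. *)
Definition fps := nat -> rat.

Definition fps_one : fps := fun n => (n == 0%N)%:R.

Definition fps_sub (f g : fps) : fps := fun n => f n - g n.

Definition fps_scale (c : rat) (f : fps) : fps := fun n => c * f n.

Definition fps_mul (f g : fps) : fps :=
  fun n => \sum_(i < n.+1) f i * g (n - i)%N.

Definition fps_pow (f : fps) (k : nat) : fps := iter k (fps_mul f) fps_one.

(* The series e^{ct}. *)
Definition fps_exp (c : rat) : fps := fun n => c ^+ n / n`!%:R.

(* (1/k!) e^{rt} (e^{t/2} - e^{-t/2})^k *)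
Definition ecf2_gf (r k : nat) : fps :=
  fps_scale (k`!%:R)^-1
    (fps_mul (fps_exp r%:R)
       (fps_pow (fps_sub (fps_exp (1 / 2%:R)) (fps_exp (- (1 / 2%:R)))) k)).

(* T_r(m, l).  The arguments are the shifted ones, m = n + r and l = k + r; the
   value is meaningful for r <= l <= m only (the subtractions are truncated).
   [ecf2E] below is the defining power series identity. *)
Definition ecf2 (r m l : nat) : rat :=
  ((m - r)%N)`!%:R * ecf2_gf r (l - r)%N (m - r)%N.

Lemma fps_pow_sub_exp_eq0 (c d : rat) (k n : nat) :
  (n < k)%N -> fps_pow (fps_sub (fps_exp c) (fps_exp d)) k n = 0.
Proof.
elim: k n => [//|k IHk] n lt_nk; rewrite /fps_pow iterS -/(fps_pow _ _).
rewrite /fps_mul big1 // => -[[|i] lt_in] _ /=.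
  by rewrite /fps_sub /fps_exp !expr0 subrr mul0r.
rewrite IHk ?mulr0 // ltn_subLR //.
by rewrite (leq_trans lt_nk) // addSn ltnS leq_addl.
Qed.

Lemma ecf2_gf_eq0 (r k n : nat) : (n < k)%N -> ecf2_gf r k n = 0.
Proof.
move=> lt_nk; rewrite /ecf2_gf /fps_scale /fps_mul big1 ?mulr0 // => i _.
by rewrite fps_pow_sub_exp_eq0 ?mulr0 // (leq_ltn_trans (leq_subr _ _)).
Qed.

(* (1/k!) e^{rt} (e^{t/2} - e^{-t/2})^k = \sum_(n >= k) T_r(n+r, k+r) t^n / n! *)
Lemma ecf2E (r k : nat) :
  ecf2_gf r k =1
    (fun n => if (k <= n)%N then ecf2 r (n + r)%N (k + r)%N / n`!%:R else 0).
Proof.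
move=> n; case: leqP => [_|/ecf2_gf_eq0->//].
rewrite /ecf2 !addnK mulrC mulKf // pnatr_eq0 -lt0n fact_gt0 //.
Qed.

(* The central factorial x^{[n]}, as a polynomial in x = 'X. *)
Definition cfact (n : nat) : {poly rat} :=
  if n == 0%N then 1
  else 'X * \prod_(1 <= j < n) ('X + (n%:R / 2%:R - j%:R)%:P).

(* Main.v *)
Require Import Defs.
From HB Require Import structures.
From mathcomp Require Import all_boot all_order all_algebra.
From mathcomp Require Import ring.
Import Order.TTheory GRing.Theory Num.Theory.
Local Open Scope ring_scope.

(** Let delta be the central difference operator and s(t) = e^(t/2) - e^(-t/2).
    Both q_n = (x + r)^n / n! and q_n = \sum_k (T_r(n+r, k+r) / n!) x^[k] have
    value r^n / n! at 0 and satisfy delta q_n = \sum_(i <= n) s_i q_(n-i); for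
    the second this follows from delta x^[k+1] = (k+1) x^[k].  As s_0 = 0 and a
    polynomial is determined by its value at 0 and its central difference, they
    agree by strong induction on n. *)

Definition fps_2sinh_half : fps :=
  fps_sub (fps_exp (1 / 2%:R)) (fps_exp (- (1 / 2%:R))).

Lemma coefM_poly_fps (f g : fps) (N n : nat) : (n < N)%N ->
  ((\poly_(i < N) f i) * (\poly_(i < N) g i))`_n = fps_mul f g n.
Proof.
move=> lt_nN; rewrite coefM; apply: eq_bigr => i _; rewrite !coef_poly.
have le_in : (i <= n)%N by rewrite -ltnS.
by rewrite (leq_ltn_trans le_in lt_nN) (leq_ltn_trans (leq_subr _ _) lt_nN).
Qed.

(** The coefficient at [n] involves only coefficients up to [n], so the series may be truncated to
    polynomials, whose product is commutative and associative. *)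
Lemma fps_mulCA (f g h : fps) :
  fps_mul f (fps_mul g h) =1 fps_mul g (fps_mul f h).
Proof.
move=> n.
have triple (a b c : fps) : fps_mul a (fps_mul b c) n =
    ((\poly_(i < n.+1) a i) *
     ((\poly_(i < n.+1) b i) * (\poly_(i < n.+1) c i)))`_n.
  rewrite coefM; apply: eq_bigr => i _.
  by rewrite coefM_poly_fps ?coef_poly ?ltn_ord // ltnS leq_subr.
by rewrite !triple mulrCA.
Qed.

(** One more factor s(t) turns the k-th series into the next one, up to the ratio k! / (k+1)!;
    [fps_mulCA] moves that factor in front of e^(rt). *)
Lemma ecf2_gfS (r k n : nat) :
  ecf2_gf r k.+1 n * k.+1%:R =
    \sum_(i < n.+1) fps_2sinh_half i * ecf2_gf r k (n - i)%N.
Proof.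
rewrite /ecf2_gf -/fps_2sinh_half /fps_scale /fps_pow iterS -/(fps_pow _ _).
rewrite fps_mulCA {1}/fps_mul mulr_sumr mulr_suml; apply: eq_bigr => i _.
have k1_neq0 : k.+1%:R != 0 :> rat by rewrite pnatr_eq0.
have kf_neq0 : k`!%:R != 0 :> rat by rewrite pnatr_eq0 -lt0n fact_gt0.
rewrite factS natrM invfM.
set y := fps_mul _ _ _; set z := fps_2sinh_half i.
by field; rewrite kf_neq0 nat1r.
Qed.

Lemma ecf2_gf0 (r n : nat) : ecf2_gf r 0 n = r%:R ^+ n / n`!%:R.
Proof.
rewrite /ecf2_gf /fps_scale /fps_mul /fps_pow /= invr1 mul1r big_ord_recr /=.
rewrite subnn mulr1 big1 ?add0r // => i _.
by rewrite /fps_one subn_eq0 leqNgt ltn_ord mulr0.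
Qed.

Definition central_diff (p : {poly rat}) : {poly rat} :=
  (p \Po ('X + (1 / 2%:R)%:P)) - (p \Po ('X + (- (1 / 2%:R))%:P)).

Lemma central_diff_is_linear : linear central_diff.
Proof.
move=> a p q; rewrite /central_diff !comp_polyD !comp_polyZ.
by rewrite opprD addrACA -scalerBr.
Qed.

HB.instance Definition _ :=
  GRing.isLinear.Build rat {poly rat} {poly rat} _ central_diff
    central_diff_is_linear.

(* A zero central difference makes the polynomial 1-periodic, so a zero at 0
   propagates to all natural numbers. *)
Lemma central_diff_eq0 (p : {poly rat}) :
  central_diff p = 0 -> p.[0] = 0 -> p = 0.
Proof.
move=> dp0 p0.
have root_nat (m : nat) : p.[m%:R] = 0.
  elim: m => [//|m IHm].
  (* At the half-integer m + 1/2 the two shifts land on m + 1 and m. *)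
  have /eqP := congr1 (fun q => q.[m%:R + 1 / 2%:R]) dp0.
  rewrite /central_diff hornerD hornerN !horner_comp !hornerE subr_eq0 => /eqP.
  have -> : m%:R + 1 / 2%:R + 1 / 2%:R = m.+1%:R :> rat.
    by rewrite -natr1; field.
  have -> : m%:R + 1 / 2%:R - 1 / 2%:R = m%:R :> rat by field.
  by move=> ->.
(* A nonzero [p] has degree [size p] - 1, hence fewer than [size p] distinct roots. *)
apply: (@roots_geq_poly_eq0 _ p [seq m%:R | m <- iota 0 (size p)]).
- by apply/allP => _ /mapP[m _ ->]; rewrite /root root_nat.
- by rewrite map_inj_uniq ?iota_uniq // => a b /eqP; rewrite eqr_nat => /eqP.
- by rewrite size_map size_iota.
Qed.

Lemma cfact_at0 (k : nat) : (cfact k).[0] = (k == 0%N)%:R.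
Proof. by case: k => [|k]; rewrite /cfact /= !hornerE. Qed.

Lemma central_diff_cfact0 : central_diff (cfact 0) = 0.
Proof. by rewrite /central_diff /cfact /= !comp_polyC subrr. Qed.

(** With factors x + k/2 - i, the shift by 1/2 yields i = 0..k-1 and the shift by -1/2 yields i =
    1..k. For k > 0 the common factors i = 1..k-1 form x^[k] / x, and (x + 1/2)(x + k/2) - (x -
    1/2)(x - k/2) = (k+1) x. *)
Lemma central_diff_cfactS (k : nat) :
  central_diff (cfact k.+1) = k.+1%:R *: cfact k.
Proof.
pose fac (i : nat) : {poly rat} := 'X + (k%:R / 2%:R - i%:R)%:P.
have shift (c : rat) : (cfact k.+1) \Po ('X + c%:P) =
    ('X + c%:P) * \prod_(1 <= j < k.+1) ('X + (c + k.+1%:R / 2%:R - j%:R)%:P).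
  rewrite /cfact /= comp_polyM comp_polyX rmorph_prod /=; congr (_ * _).
  apply: eq_bigr => j _.
  by rewrite comp_polyD comp_polyX comp_polyC -!addrA !polyCD.
have plus : \prod_(1 <= j < k.+1)
    ('X + (1 / 2%:R + k.+1%:R / 2%:R - j%:R)%:P) = \prod_(0 <= i < k) fac i.
  rewrite big_add1 /=; apply: eq_bigr => i _; rewrite /fac -!natr1.
  by congr ('X + _%:P); field.
have minus : \prod_(1 <= j < k.+1)
    ('X + (- (1 / 2%:R) + k.+1%:R / 2%:R - j%:R)%:P) =
    \prod_(1 <= i < k.+1) fac i.
  by apply: eq_bigr => i _; rewrite /fac -natr1; congr ('X + _%:P); field.
rewrite /central_diff !shift plus minus {shift plus minus}.
(* For k = 0 both products are empty, so no end factors can be split off. *)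
case: k @fac => [|k] fac.
  rewrite /cfact /= !big_geq // !mulr1 scale1r opprD addrACA subrr add0r.
  by rewrite -polyCN -polyCD; congr _%:P; field.
rewrite big_nat_recl // big_nat_recr //= /cfact /= big_add1 /=.
set M := \prod_(0 <= i < k) _.
rewrite -mul_polyC /fac.
set u := (_ - 0%:R)%:P; set v := (_ - k.+1%:R)%:P.
have -> : u = (k.+1%:R / 2%:R)%:P by congr _%:P; rewrite subr0.
have -> : v = - (k.+1%:R / 2%:R)%:P by rewrite -polyCN; congr _%:P; field.
(* The scalar is written in the constants a = 1/2 and b = (k+1)/2, which [ring] treats as atoms. *)
have -> : k.+2%:R%:P =
    (1 / 2%:R)%:P * 2%:R + (k.+1%:R / 2%:R)%:P * 2%:R :> {poly rat}.
  by rewrite -(polyC_natr _ 2) -!polyCM -polyCD -natr1; congr _%:P; field.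
by rewrite polyCN; ring.
Qed.

(** By Taylor, the shift by d is e^(dD) with D = d/dx, so the central difference is s(D), and D^i
    lowers (x + c)^n / n! to (x + c)^(n-i) / (n-i)!. *)
Lemma central_diff_exp (c : rat) (n : nat) :
  central_diff (n`!%:R^-1 *: ('X + c%:P) ^+ n) =
    \sum_(i < n.+1) fps_2sinh_half i *:
      ((n - i)`!%:R^-1 *: ('X + c%:P) ^+ (n - i)).
Proof.
have taylor (d : rat) : (n`!%:R^-1 *: ('X + c%:P) ^+ n) \Po ('X + d%:P) =
    \sum_(i < n.+1) fps_exp d i *: ((n - i)`!%:R^-1 *: ('X + c%:P) ^+ (n - i)).
  rewrite comp_polyZ rmorphXn /= comp_polyD comp_polyX comp_polyC addrAC.
  rewrite exprDn scaler_sumr; apply: eq_bigr => i _.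
  have le_in : (i <= n)%N by rewrite -ltnS.
  have fact_neq0 (m : nat) : m`!%:R != 0 :> rat.
    by rewrite pnatr_eq0 -lt0n fact_gt0.
  rewrite -polyC_exp mulrC mul_polyC -scaler_nat !scalerA; congr (_ *: _).
  rewrite /fps_exp -(bin_fact le_in) !natrM.
  by field; rewrite !fact_neq0 pnatr_eq0 -lt0n bin_gt0 le_in.
rewrite /central_diff !taylor -sumrB; apply: eq_bigr => i _.
by rewrite -scalerBl.
Qed.

Definition ecf2_poly (r n : nat) : {poly rat} :=
  \sum_(k < n.+1) ecf2_gf r k n *: cfact k.

(** The added terms vanish since the k-th series has order at least k; a common range lets sums over
    different n be exchanged. *)
Lemma ecf2_poly_widen (r n N : nat) : (n < N)%N ->
  ecf2_poly r n = \sum_(k < N) ecf2_gf r k n *: cfact k.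
Proof.
move=> lt_nN; rewrite /ecf2_poly.
rewrite (big_ord_widen N (fun k => ecf2_gf r k n *: cfact k)) // big_mkcond.
apply: eq_bigr => k _; case: ltnP => // lt_nk.
by rewrite ecf2_gf_eq0 ?scale0r.
Qed.

Lemma ecf2_poly_at0 (r n : nat) : (ecf2_poly r n).[0] = r%:R ^+ n / n`!%:R.
Proof.
rewrite /ecf2_poly horner_sum big_ord_recl big1 => [|i _].
  by rewrite hornerZ cfact_at0 mulr1 addr0 ecf2_gf0.
by rewrite hornerZ cfact_at0 mulr0.
Qed.

(** The factor k+1 from differencing x^[k+1] is exactly the one absorbed by [ecf2_gfS]. *)
Lemma central_diff_ecf2_poly (r n : nat) :
  central_diff (ecf2_poly r n) =
    \sum_(i < n.+1) fps_2sinh_half i *: ecf2_poly r (n - i).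
Proof.
(* The range is widened to [n.+2] because the k = 0 term dies and the index drops by one, leaving
   [n.+1] terms. *)
rewrite (ecf2_poly_widen _ _ _ (ltnW (ltnSn n.+1))) linear_sum big_ord_recl /=.
rewrite linearZ /= central_diff_cfact0 scaler0 add0r.
under eq_bigr => k _.
  rewrite linearZ /= central_diff_cfactS scalerA ecf2_gfS scaler_suml.
  over.
rewrite exchange_big /=; apply: eq_bigr => i _.
rewrite (ecf2_poly_widen r (n - i) n.+1) ?ltnS ?leq_subr // scaler_sumr.
by apply: eq_bigr => k _; rewrite scalerA.
Qed.

Lemma ecf2_polyE (r n : nat) :
  ecf2_poly r n = n`!%:R^-1 *: ('X + r%:R%:P) ^+ n.
Proof.
elim/ltn_ind: n => n IHn; apply/eqP; rewrite -subr_eq0; apply/eqP.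
apply: central_diff_eq0; last first.
  by rewrite hornerD hornerN ecf2_poly_at0 !hornerE mulrC subrr.
rewrite linearB /= central_diff_ecf2_poly central_diff_exp -sumrB.
apply: big1 => -[[|i] lt_in] _ /=.
  by rewrite /fps_2sinh_half /fps_sub /fps_exp !expr0 subrr !scale0r subrr.
by rewrite IHn ?subrr // -subSn // subSS leq_subr.
Qed.

Theorem theorem2p10 (r n : nat) :
  ('X + (r%:R)%:P) ^+ n =
    \sum_(0 <= k < n.+1) ecf2 r (n + r)%N (k + r)%N *: cfact k :> {poly rat}.
Proof.
have nf_neq0 : n`!%:R != 0 :> rat by rewrite pnatr_eq0 -lt0n fact_gt0.
rewrite big_mkord; under eq_bigr => k _ do rewrite /ecf2 !addnK -scalerA.
rewrite -scaler_sumr -/(ecf2_poly r n) ecf2_polyE scalerA mulfV //.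
by rewrite scale1r.
Qed.
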